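(* Let $A\in\mathbb{R}^{m\times n}$, $b\in\mathbb{R}^m$, let $g:\mathbb{R}^n\to\mathbb{R}\cup\{\infty\}$ be a proper convex function, let $\beta>0$, let $S\in\mathbb{R}^{n\times n}$ be symmetric positive semidefinite, and put $f(x)=\frac12\|Ax-b\|^2$ and $M=A^\top A+\beta I$. Assume that the set $\Omega^*$ of KKT points of the problem of minimizing $f(x)+g(y)$ subject to $x-y=0$, $x,y\in\mathbb{R}^n$, is nonempty. Let $\{(x^k,y^k,\lambda^k)\}_{k\ge 0}$ be an (infinite) sequence generated by the algorithm ADM-BFGS (defined in the context, with either the BFGS or the L-BFGS update of $H_k$ with respect to $M$), and let $T_k=H_k^{-1}-M$ for $k\ge0$. Suppose that there exist a symmetric positive semidefinite matrix $T$ and a sequence of real numbers $\{\gamma_k\}_{k\ge 0}$ such that (i) $T\preceq T_{k+1}\preceq(1+\gamma_k)T_k$ for all $k\ge0$; (ii) $\gamma_k\ge 0$ for all $k\ge0$ and $\sum_{k=0}^\infty\gamma_k<\infty$. Then the sequence $\{(x^k,y^k,\lambda^k)\}$ converges to a point $(x^*,y^*,\lambda^* )\in\Omega^*$.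
   Context: Notation: $\|\cdot\|$ is the Euclidean norm; for a symmetric positive semidefinite matrix $G$, $\|z\|_G=\sqrt{z^\top G z}$; for symmetric matrices $P\preceq Q$ means $Q-P$ is positive semidefinite; $\partial$ denotes the convex subdifferential. KKT points: $(x^*,y^*,\lambda^* )\in\mathbb{R}^n\times\mathbb{R}^n\times\mathbb{R}^n$ belongs to $\Omega^*$ if there are $\eta_f^*\in\partial f(x^* )$ and $\eta_g^*\in\partial g(y^* )$ with $\eta_f^*-\lambda^*=0$, $\eta_g^*+\lambda^*=0$, and $x^*-y^*=0$. BFGS update: given a symmetric positive definite matrix $H$ and a vector $s\ne0$, with $l=Ms$, the BFGS update of $H$ with respect to $s$ is $$\left(I-\frac{s l^\top}{s^\top l}\right)H\left(I-\frac{l s^\top}{s^\top l}\right)+\frac{s s^\top}{s^\top l}.$$ Algorithm ADM-BFGS: fix an initial point $(x^0,y^0,\lambda^0)$, a symmetric positive definite matrix $H_0$ with $H_0\preceq M^{-1}$, and $\bar k\in[1,\infty]$ (possibly $\bar k=\infty$). Write $s_i=x^{i+1}-x^i$ and $l_i=Ms_i$. For $k=0,1,2,\dots$: 1. (For $k\ge1$.) If $k\le\bar k$ and $x^k-x^{k-1}\ne0$, compute $H_k$ by one of the following rules (the same rule being used throughout the run). BFGS: $H_k$ is the BFGS update of $H_{k-1}$ with respect to $s_{k-1}$. L-BFGS with memory $h\ge1$: $H_k$ is obtained from $H_0$ by applying successively, in increasing order of $i$, the BFGS updates with respect to those $s_i$ with $\max(0,k-h)\le i\le k-1$ and $s_i\neq0$.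 Otherwise set $H_k=H_{k-1}$. 2. $x^{k+1}=x^k+H_k\left(\lambda^k+\beta y^k+A^\top b-Mx^k\right)$. 3. $y^{k+1}$ is a minimizer over $y\in\mathbb{R}^n$ of $g(y)-\langle\lambda^k,x^{k+1}-y\rangle+\frac{\beta}{2}\|x^{k+1}-y\|^2+\frac12\|y-y^k\|_S^2$. 4. $\lambda^{k+1}=\lambda^k-\beta(x^{k+1}-y^{k+1})$.
   Formalization: The formal theorem additionally assumes that g is closed (lower semicontinuous); without this the claim fails, e.g. for g the indicator of an open half-plane, where the iterates can converge to a boundary point outside dom g. *)

(* Defs.v *)
From HB Require Import structures.
From mathcomp Require Import all_boot all_order all_algebra.
From mathcomp Require Import all_classical all_reals all_analysis.
Set Implicit Arguments.
Unset Strict Implicit.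
Unset Printing Implicit Defensive.
Import Order.TTheory GRing.Theory Num.Theory.
Import numFieldNormedType.Exports.
Local Open Scope classical_set_scope.
Local Open Scope ring_scope.

Section Euclidean.
Variables (R : realType) (n : nat).
Implicit Types (u v z : 'cV[R]_n) (G P Q : 'M[R]_n).

Definition dot u v : R := (u^T *m v) 0 0.

(* The library norm [`|u|] on matrices is the sup norm, hence [enorm]. *)
Definition enorm u : R := Num.sqrt (dot u u).

Definition gnorm G z : R := Num.sqrt ((z^T *m G *m z) 0 0).

Definition psd G : Prop :=
  G^T = G /\ forall z, 0 <= (z^T *m G *m z) 0 0.

Definition posdef G : Prop :=
  G^T = G /\ forall z, z != 0 -> 0 < (z^T *m G *m z) 0 0.

Definition loewner_le P Q : Prop := psd (Q - P).

End Euclidean.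

Section ConvexFunctions.
Variables (R : realType) (n : nat).
Implicit Types (g : 'cV[R]_n -> \bar R).
Local Open Scope ereal_scope.

(* [proper_efun g] excludes the value -oo, so g takes values in R U {+oo}. *)
Definition proper_efun g : Prop :=
  (forall x, g x != -oo) /\ (exists x, g x != +oo).

(* For proper g there is no undefined sum -oo + +oo, and the endpoints t = 0, *)
(* t = 1 are harmless because 0 * +oo = 0 in [\bar R].                        *)
Definition econvex g : Prop :=
  forall (x y : 'cV[R]_n) (t : R), (0 <= t <= 1)%R ->
    g (t *: x + (1 - t) *: y)%R <= t%:E * g x + (1 - t)%:E * g y.

(* For proper g, membership forces g x to be finite (take z with g z finite). *)
Definition subdiff g (x : 'cV[R]_n) : set 'cV[R]_n :=
  [set eta | forall z, g x + (dot eta (z - x)%R)%:E <= g z].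

Definition is_minimizer g (x : 'cV[R]_n) : Prop := forall z, g x <= g z.

End ConvexFunctions.

Section KKT.
Variables (R : realType) (n : nat).
Local Notation vec := 'cV[R]_n.

Definition kkt (f : vec -> R) (g : vec -> \bar R) : set (vec * vec * vec) :=
  [set w | let: (x, y, lam) := w in
    exists eta_f eta_g : vec,
      [/\ subdiff (EFin \o f) x eta_f, subdiff g y eta_g,
          eta_f - lam = 0, eta_g + lam = 0 & x - y = 0]].

End KKT.

Section Algorithm.
Variable R : realType.

Definition least_squares m n (A : 'M[R]_(m, n)) (b : 'cV[R]_m)
    (x : 'cV[R]_n) : R :=
  2^-1 * enorm (A *m x - b) ^+ 2.

Definition bfgs_update n (M H : 'M[R]_n) (s : 'cV[R]_n) : 'M[R]_n :=
  let l := M *m s in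
  let sl := dot s l in
  (1%:M - sl^-1 *: (s *m l^T)) *m H *m (1%:M - sl^-1 *: (l *m s^T))
    + sl^-1 *: (s *m s^T).

(* [LBFGS h _] is the limited-memory rule with memory h >= 1. *)
Inductive qn_rule : Type :=
| BFGS
| LBFGS (h : nat) of (0 < h)%N.

Definition increment n (x : nat -> 'cV[R]_n) (i : nat) : 'cV[R]_n :=
  x i.+1 - x i.

(* The matrix prescribed by [rule] at iteration k >= 1.  In the L-BFGS case i *)
(* ranges over max(0, k - h) <= i <= k - 1, the subtraction on nat being      *)
(* truncated.                                                                 *)
Definition qn_matrix n (rule : qn_rule) (M : 'M[R]_n) (H : nat -> 'M[R]_n)
    (x : nat -> 'cV[R]_n) (k : nat) : 'M[R]_n :=
  match rule with
  | BFGS => bfgs_update M (H k.-1) (increment x k.-1)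
  | LBFGS h _ =>
      foldl (bfgs_update M) (H 0%N)
        [seq increment x i | i <- index_iota (k - h) k & increment x i != 0]
  end.

Definition y_objective n (g : 'cV[R]_n -> \bar R) (beta : R) (S : 'M[R]_n)
    (xnext yk lamk y : 'cV[R]_n) : \bar R :=
  (g y + (- dot lamk (xnext - y) + beta / 2 * enorm (xnext - y) ^+ 2
          + 2^-1 * gnorm S (y - yk) ^+ 2)%:E)%E.

Definition admM m n (A : 'M[R]_(m, n)) (beta : R) : 'M[R]_n :=
  A^T *m A + beta%:M.

Definition Tmx m n (A : 'M[R]_(m, n)) (beta : R) (H : nat -> 'M[R]_n)
    (k : nat) : 'M[R]_n :=
  invmx (H k) - admM A beta.

Record adm_bfgs m n (A : 'M[R]_(m, n)) (b : 'cV[R]_m)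
    (g : 'cV[R]_n -> \bar R) (beta : R) (S : 'M[R]_n)
    (rule : qn_rule) (kbar : \bar R)
    (H : nat -> 'M[R]_n) (x y lam : nat -> 'cV[R]_n) : Prop := AdmBfgs {
  adm_H0_posdef : posdef (H 0%N);
  adm_H0_le : loewner_le (H 0%N) (invmx (admM A beta));
  adm_kbar : (1 <= kbar)%E;
  adm_H_update : forall k, (0 < k)%N ->
    (k%:R%:E <= kbar)%E -> x k - x k.-1 != 0 ->
    H k = qn_matrix rule (admM A beta) H x k;
  adm_H_keep : forall k, (0 < k)%N ->
    ~ ((k%:R%:E <= kbar)%E /\ x k - x k.-1 != 0) ->
    H k = H k.-1;
  adm_x : forall k,
    x k.+1 = x k + H k *m (lam k + beta *: y k + A^T *m b
                           - admM A beta *m x k);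
  adm_y : forall k,
    is_minimizer (y_objective g beta S (x k.+1) (y k) (lam k)) (y k.+1);
  adm_lam : forall k,
    lam k.+1 = lam k - beta *: (x k.+1 - y k.+1)
}.

End Algorithm.

(* Main.v *)
Require Import Defs.
From HB Require Import structures.
From mathcomp Require Import all_boot all_order all_algebra.
From mathcomp Require Import all_classical all_reals all_analysis.
From mathcomp Require Import ring lra.
Set Implicit Arguments.
Unset Strict Implicit.
Unset Printing Implicit Defensive.
Import Order.TTheory GRing.Theory Num.Theory.
Import numFieldNormedType.Exports.
Local Open Scope classical_set_scope.
Local Open Scope ring_scope.

(** Condition (i) makes [H_k^-1 = T_k + M] positive definite and [T_k]
    positive semidefinite for [k >= 1].  The [x]-step then reads
    [grad f(x^{k+1}) = lam^{k+1} - beta (y^{k+1} - y^k) - T_k (x^{k+1} - x^k)]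
    and the [y]-step [- lam^{k+1} - S (y^{k+1} - y^k) \in dg(y^{k+1})].  By
    monotonicity of the subdifferentials, for every KKT point the quantity
    [|lam^k - lam*|^2 / beta + beta |y^k - y*|^2 + |y^k - y*|_S^2
     + |x^k - x*|_{T_k}^2 + |y^k - y^{k-1}|_S^2]
    decreases, up to the summable factor [1 + gamma_k], by the same energy of
    the last increment.  Hence it stays bounded and the increments vanish, so
    cluster points of the iterates are KKT points.  Taking a cluster point as
    the reference point, the quantity is arbitrarily small at some index, hence
    at all later ones. *)

(** * Euclidean inner product and semidefinite quadratic forms *)

Lemma dotE (R : realType) (n : nat) (u v : 'cV[R]_n) :
  dot u v = \sum_i u i 0 * v i 0.
Proof. by rewrite /dot mxE; apply: eq_bigr => i _; rewrite mxE. Qed.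

Lemma dotC (R : realType) (n : nat) (u v : 'cV[R]_n) : dot u v = dot v u.
Proof. by rewrite !dotE; apply: eq_bigr => i _; rewrite mulrC. Qed.

Lemma dotDr (R : realType) (n : nat) (u v w : 'cV[R]_n) :
  dot u (v + w) = dot u v + dot u w.
Proof. by rewrite /dot mulmxDr mxE. Qed.

Lemma dotZr (R : realType) (n : nat) (a : R) (u v : 'cV[R]_n) :
  dot u (a *: v) = a * dot u v.
Proof. by rewrite /dot -scalemxAr mxE. Qed.

Lemma dotNr (R : realType) (n : nat) (u v : 'cV[R]_n) : dot u (- v) = - dot u v.
Proof. by rewrite /dot mulmxN mxE. Qed.

Lemma dotDl (R : realType) (n : nat) (u v w : 'cV[R]_n) :
  dot (u + v) w = dot u w + dot v w.
Proof. by rewrite !(dotC _ w) dotDr. Qed.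

Lemma dotZl (R : realType) (n : nat) (a : R) (u v : 'cV[R]_n) :
  dot (a *: u) v = a * dot u v.
Proof. by rewrite !(dotC _ v) dotZr. Qed.

Lemma dotNl (R : realType) (n : nat) (u v : 'cV[R]_n) : dot (- u) v = - dot u v.
Proof. by rewrite !(dotC _ v) dotNr. Qed.

Lemma dot_mulmxr (R : realType) (m n : nat) (A : 'M[R]_(m, n))
    (u : 'cV[R]_m) (v : 'cV[R]_n) : dot u (A *m v) = dot (A^T *m u) v.
Proof. by rewrite /dot trmx_mul trmxK mulmxA. Qed.

Definition linE := (mulmxDr, mulmxN, dotDl, dotDr, dotNl, dotNr, dotZl, dotZr,
  mulmxDl, mulNmx).

Lemma dot_ge0 (R : realType) (n : nat) (u : 'cV[R]_n) : 0 <= dot u u.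
Proof. by rewrite dotE sumr_ge0// => i _; rewrite -expr2 sqr_ge0. Qed.

Lemma sqr_coord_le_dot (R : realType) (n : nat) (u : 'cV[R]_n) (i : 'I_n) :
  u i 0 ^+ 2 <= dot u u.
Proof.
rewrite dotE (bigD1 i)//= expr2 lerDl sumr_ge0// => j _.
by rewrite -expr2 sqr_ge0.
Qed.

Lemma sqr_enorm (R : realType) (n : nat) (u : 'cV[R]_n) : enorm u ^+ 2 = dot u u.
Proof. by rewrite sqr_sqrtr// dot_ge0. Qed.

Lemma quadE (R : realType) (n : nat) (G : 'M[R]_n) (z : 'cV[R]_n) :
  (z^T *m G *m z) 0 0 = dot z (G *m z).
Proof. by rewrite /dot mulmxA. Qed.

Lemma psd_ge0 (R : realType) (n : nat) (G : 'M[R]_n) (z : 'cV[R]_n) :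
  psd G -> 0 <= dot z (G *m z).
Proof. by case=> _ /(_ z); rewrite quadE. Qed.

Lemma psd_sym (R : realType) (n : nat) (G : 'M[R]_n) (u v : 'cV[R]_n) :
  psd G -> dot u (G *m v) = dot v (G *m u).
Proof. by case=> GT _; rewrite dot_mulmxr GT dotC. Qed.

Lemma sqr_gnorm (R : realType) (n : nat) (G : 'M[R]_n) (z : 'cV[R]_n) :
  psd G -> Defs.gnorm G z ^+ 2 = dot z (G *m z).
Proof. by move=> G0; rewrite sqr_sqrtr quadE// psd_ge0. Qed.

Lemma psdD (R : realType) (n : nat) (P Q : 'M[R]_n) :
  psd P -> psd Q -> psd (P + Q).
Proof.
move=> P0 Q0; split => [|z]; first by rewrite linearD/= P0.1 Q0.1.
by rewrite quadE mulmxDl dotDr addr_ge0// psd_ge0.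
Qed.

Lemma loewner_leP (R : realType) (n : nat) (P Q : 'M[R]_n) (z : 'cV[R]_n) :
  loewner_le P Q -> dot z (P *m z) <= dot z (Q *m z).
Proof.
by move=> /(psd_ge0 z); rewrite mulmxBl dotDr dotNr subr_ge0.
Qed.

Lemma psd_loewner (R : realType) (n : nat) (P Q : 'M[R]_n) :
  psd P -> loewner_le P Q -> psd Q.
Proof. by move=> P0 PQ; rewrite -(subrK P Q); apply: psdD. Qed.

(** The form may be degenerate, so instead of dividing by [dot v (G *m v)] one tests nonnegativity
    of the form on well-chosen combinations of [u] and [v]. *)
Lemma psd_cauchy_schwarz (R : realType) (n : nat) (G : 'M[R]_n)
    (u v : 'cV[R]_n) : psd G ->
  dot u (G *m v) ^+ 2 <= dot u (G *m u) * dot v (G *m v).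
Proof.
move=> G0; have Q (s t : R) : 0 <= s ^+ 2 * dot u (G *m u)
    + 2 * s * t * dot u (G *m v) + t ^+ 2 * dot v (G *m v).
  have := psd_ge0 (s *: u + t *: v) G0.
  rewrite !(linE, =^~ scalemxAr) (psd_sym v u G0); lra.
set a := dot u (G *m u) in Q *; set b := dot u (G *m v) in Q *.
set c := dot v (G *m v) in Q *.
have a0 : 0 <= a by exact: psd_ge0.
have c0 : 0 <= c by exact: psd_ge0.
have [ac0|] := ltP 0 (a + c).
  (* The two values are c (ac - b^2) and a (ac - b^2); their sum has the sign of ac - b^2 because a
     + c > 0. *)
  have := Q c (- b); have := Q (- b) a; nra.
move=> ac; have {}a0 : a = 0 by lra.
have {}c0 : c = 0 by lra.
(* With a = c = 0 this value is -2 b^2, which forces b = 0. *)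
by have := Q 1 (- b); rewrite a0 c0; nra.
Qed.

(** A row [u] in the kernel satisfies u G u^T + beta |u|^2 = 0 with both terms nonnegative, hence
    vanishes. *)
Lemma psd_scalar_unit (R : realType) (n : nat) (G : 'M[R]_n) (beta : R) :
  0 < beta -> psd G -> G + beta%:M \in unitmx.
Proof.
move=> b0 G0; rewrite -row_free_unit -kermx_eq0.
apply/eqP/row_matrixP => i; rewrite row0.
set u := row i _; have u0 : u *m (G + beta%:M) = 0.
  by rewrite /u -row_mul mulmx_ker row0.
have : dot u^T ((G + beta%:M) *m u^T) = 0.
  by rewrite /dot trmxK mulmxA u0 mul0mx mxE.
rewrite mulmxDl mul_scalar_mx dotDr dotZr => h.
have dd : dot u^T u^T = 0.
  by have := psd_ge0 u^T G0; have := dot_ge0 u^T; nra.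
apply/rowP => j; rewrite [RHS]mxE; have := sqr_coord_le_dot u^T j.
by rewrite dd mxE => h2; apply/eqP; rewrite -sqrf_eq0 eq_le h2 sqr_ge0.
Qed.

(** * Entrywise convergence and limits along ultrafilters *)

Lemma cvg_colP (R : realType) (n : nat) (I : Type) (F : set_system I)
    (u : I -> 'cV[R]_n) (l : 'cV[R]_n) : Filter F ->
  u @ F --> l <-> forall i, u k i 0 @[k --> F] --> l i 0.
Proof.
move=> FF; split => [ul i|ul V [P Pl PV]].
  apply: (@cvg_comp _ _ _ u (fun M : 'cV[R]_n => M i 0) _ _ _ ul).
  exact: coord_continuous.
have : \forall k \near F, forall i, P i 0 (u k i 0).
  by apply: filter_forall => i; exact: ul.
by apply: filterS => k Pk; apply: PV => i j; rewrite ord1; exact: Pk.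
Qed.

Lemma cvg_dot (R : realType) (n : nat) (I : Type) (F : set_system I)
    (u v : I -> 'cV[R]_n) (l m : 'cV[R]_n) : Filter F ->
  u @ F --> l -> v @ F --> m -> dot (u k) (v k) @[k --> F] --> dot l m.
Proof.
move=> FF /cvg_colP ul /cvg_colP vm; rewrite dotE; under eq_fun do rewrite dotE.
by apply: cvg_big => [|i _]; [exact: add_continuous|exact: cvgM].
Qed.

Lemma cvg_mulmx (R : realType) (m n : nat) (I : Type) (F : set_system I)
    (A : 'M[R]_(m, n)) (u : I -> 'cV[R]_n) (l : 'cV[R]_n) : Filter F ->
  u @ F --> l -> A *m u k @[k --> F] --> A *m l.
Proof.
move=> FF /cvg_colP ul; apply/cvg_colP => i; rewrite mxE; under eq_fun do rewrite mxE.
by apply: cvg_big => [|j _]; [exact: add_continuous|apply: cvgM => //; exact: cvg_cst].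
Qed.

Lemma cvg_dot0 (R : realType) (n : nat) (I : Type) (F : set_system I)
    (u : I -> 'cV[R]_n) : Filter F ->
  dot (u k) (u k) @[k --> F] --> 0 -> u @ F --> (0 : 'cV[R]_n).
Proof.
move=> FF u0; apply/cvg_colP => i; rewrite mxE.
apply/norm_cvg0P; rewrite -sqrtr0.
under eq_fun do rewrite -sqrtr_sqr.
apply: (continuous_cvg _ (@sqrt_continuous R 0)).
apply: (squeeze_cvgr _ (cvg_cst 0) u0).
by near=> k; rewrite sqr_ge0 sqr_coord_le_dot.
Unshelve. all: by end_near.
Qed.

(** Compactness gives a cluster point of the image filter. An ultrafilter contains the preimage of
    each neighbourhood or of its complement, and clustering excludes the complement. *)
Lemma ultra_cvg_compact (I : Type) (T : topologicalType) (F : set_system I)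
    (A : set T) (u : I -> T) :
  UltraFilter F -> compact A -> (forall k, A (u k)) -> exists p : T, u @ F --> p.
Proof.
move=> FU Aco uA; have FF : ProperFilter F by exact: ultra_proper.
have [|p [_ clp]] := Aco (u @ F) (fmap_proper_filter u FF).
  by apply: (@filterE _ F) => k; exact: uA.
exists p => V Vp; have [//|FV] := in_ultra_setVsetC (u @^-1` V) FU.
by have [q [/= nVq Vq]] := clp (~` V) V FV Vp.
Qed.

(** Bolzano-Weierstrass for ultrafilters: each coordinate stays in the compact segment from -sqrt B
    to sqrt B. *)
Lemma ultra_cvg_bounded (R : realType) (n : nat) (I : Type) (F : set_system I)
    (u : I -> 'cV[R]_n) (B : R) : UltraFilter F ->
  (forall k, dot (u k) (u k) <= B) -> exists l : 'cV[R]_n, u @ F --> l.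
Proof.
move=> FU uB; have FF : ProperFilter F by exact: ultra_proper.
have /choice[l ul] : forall i, exists p : R, u k i 0 @[k --> F] --> p.
  move=> i; apply: (ultra_cvg_compact _ (@segment_compact R (- Num.sqrt B) (Num.sqrt B))).
  move=> k /=; rewrite in_itv/= -ler_norml -sqrtr_sqr ler_wsqrtr//.
  exact: le_trans (sqr_coord_le_dot _ _) (uB k).
by exists (\col_i l i); apply/cvg_colP => i; rewrite mxE.
Qed.

(** * Subdifferentials: monotonicity, Fermat's rule, closed graph *)

Lemma subdiff_fin_num (R : realType) (n : nat) (g : 'cV[R]_n -> \bar R)
    (x eta : 'cV[R]_n) :
  proper_efun g -> subdiff g x eta -> g x \is a fin_num.
Proof.
move=> [gNy [z gz]] /(_ z) h; have := gNy x; have := gNy z.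
by case: (g z) gz h => [r||]//; case: (g x).
Qed.

Lemma subdiff_monotone (R : realType) (n : nat) (g : 'cV[R]_n -> \bar R)
    (x y eta zeta : 'cV[R]_n) : proper_efun g ->
  subdiff g x eta -> subdiff g y zeta -> 0 <= dot (x - y) (eta - zeta).
Proof.
move=> pg gx gy; move: (subdiff_fin_num pg gx) (subdiff_fin_num pg gy).
move: (gx y) (gy x); case: (g x) (g y) => [r||]// [s||]//.
rewrite -!EFinD !lee_fin !linE !(dotC x) !(dotC y) => h1 h2 _ _; lra.
Qed.

(** Fermat's rule for [g] plus a function quadratic along lines through [y], with gradient [zeta]
    there. If the subgradient inequality failed at [z] by [del > 0], comparing [y] with the point at
    fraction [t] of the way to [z] would give t del <= t^2 K, which is false for small [t]. *)
Lemma subdiff_minimizer (R : realType) (n : nat) (g : 'cV[R]_n -> \bar R)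
    (phi : 'cV[R]_n -> R) (y zeta : 'cV[R]_n) :
  proper_efun g -> econvex g ->
  is_minimizer (fun z => g z + (phi z)%:E)%E y ->
  (forall d, exists K, forall t,
     phi (y + t *: d) = phi y + t * dot zeta d + t ^+ 2 * K) ->
  subdiff g y (- zeta).
Proof.
move=> [gNy [z0 gz0]] gconv miny phiq.
have : g y \is a fin_num.
  have := miny z0; have := gNy y; have := gNy z0.
  by case: (g z0) gz0 => [r||]//; case: (g y).
case gyE : (g y) => [c||]// _ z; rewrite /= gyE.
case gzE : (g z) => [r||]; [|by rewrite leey|by have := gNy z; rewrite gzE].
have [K phiK] := phiq (z - y).
rewrite -EFinD lee_fin dotNl leNgt; apply/negP => lt_rc.
set del := c - dot zeta (z - y) - r.
have key t : 0 <= t <= 1 -> t * del <= t ^+ 2 * K.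
  move=> t01; have := gconv z y t t01.
  have -> : t *: z + (1 - t) *: y = y + t *: (z - y).
    by rewrite scalerBl scale1r scalerBr addrCA addrA addrC.
  rewrite gzE gyE -!EFinM -EFinD => /leeD2r => /(_ (phi (y + t *: (z - y)))%:E).
  move=> /(le_trans (miny _)); rewrite gyE -!EFinD lee_fin phiK /del; lra.
have del0 : 0 < del by rewrite /del; lra.
(* This [t] lies in ]0, 1] and satisfies t |K| = del - t del < del. *)
pose t := del / (del + `|K|).
have K0 := normr_ge0 K; have dK : 0 < del + `|K| by rewrite ltr_wpDr.
have tE : t * (del + `|K|) = del by rewrite /t divfK// gt_eqF.
have t0 : 0 < t by rewrite divr_gt0.
have t1 : t <= 1 by rewrite ler_pdivrMr// mul1r lerDl.
have : t * del <= t * (t * K) by rewrite mulrA -expr2 key// (ltW t0).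
rewrite ler_pM2l// => h; have := ler_norm K.
by rewrite -(ler_pM2l t0); nra.
Qed.

(** If the inequality failed at [z], some [a] would lie strictly between the limit of the affine
    bounds on [g (u k)] and [g x]. Lower semicontinuity keeps [g (u k)] above [a] eventually, so the
    limit of the bounds would be at least [a]. *)
Lemma subdiff_closed (R : realType) (n : nat) (g : 'cV[R]_n -> \bar R)
    (I : Type) (F : set_system I) (u v : I -> 'cV[R]_n) (x eta : 'cV[R]_n) :
  ProperFilter F -> proper_efun g -> lower_semicontinuous g ->
  u @ F --> x -> v @ F --> eta ->
  (forall k, subdiff g (u k) (v k)) -> subdiff g x eta.
Proof.
move=> FF pg lscg ux veta guv z; have gNy := pg.1.
case gzE : (g z) => [r||]; [|by rewrite leey|by have := gNy z; rewrite gzE].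
have cvgr : r - dot (v k) (z - u k) @[k --> F] --> r - dot eta (z - x).
  apply: cvgB; first exact: cvg_cst.
  by apply: cvg_dot => //; apply: cvgB => //; exact: cvg_cst.
rewrite leNgt; apply/negP => lt_rx.
have [a ca ax] : exists2 a, r - dot eta (z - x) < a & (a%:E < g x)%E.
  move: lt_rx; have := gNy x; case: (g x) => [s||]// _.
    rewrite -EFinD lte_fin => h; exists ((s + (r - dot eta (z - x))) / 2); last rewrite lte_fin; lra.
  by move=> _; exists (r - dot eta (z - x) + 1); [lra|rewrite ltry].
have [V /ux FV aV] := lscg _ _ ax.
suff : a <= r - dot eta (z - x) by rewrite leNgt ca.
apply: cvgr_to_ge cvgr _; near=> k.
have : V (u k) by near: k.
move=> /aV; have := guv k z; have := subdiff_fin_num pg (guv k).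
by rewrite gzE; case: (g (u k)) => [s||]// _; rewrite -EFinD lee_fin lte_fin; lra.
Unshelve. all: by end_near.
Qed.

(** * Sequences decreasing up to factors 1 + gamma_k *)

Lemma prodr_ge1 (R : realDomainType) (n : nat) (F : nat -> R) :
  (forall i, 1 <= F i) -> 1 <= \prod_(i < n) F i.
Proof.
by move=> F1; elim/big_ind : _ => // x y x1 y1; exact: mulr_ege1.
Qed.

(** Since 1 + t <= exp t, the products are bounded by the exponential of the sum. *)
Lemma summable_prod_bounded (R : realType) (gamma : nat -> R) :
  (forall k, 0 <= gamma k) -> (\sum_(0 <= k <oo) (gamma k)%:E < +oo)%E ->
  exists C, forall k, \prod_(i < k) (1 + gamma i) <= C.
Proof.
move=> g0 gs; exists (expR (fine (\sum_(0 <= k <oo) (gamma k)%:E)%E)) => k.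
have le_sum : \sum_(0 <= i < k) gamma i <= fine (\sum_(0 <= k <oo) (gamma k)%:E)%E.
  rewrite -lee_fin fineK; last first.
    by rewrite ge0_fin_numE// nneseries_ge0// => i _ _; rewrite lee_fin.
  by rewrite -sumEFin; apply: nneseries_lim_ge => i _ _; rewrite lee_fin.
apply: (le_trans (y := expR (\sum_(0 <= i < k) gamma i))); last by rewrite ler_expR.
elim: k {le_sum} => [|k ih].
  by rewrite big_ord0 big_geq// expR0.
rewrite big_ord_recr big_nat_recr//= expRD ler_pM ?expR_ge1Dx//.
- by apply: prodr_ge0 => i _; rewrite addr_ge0.
- by rewrite addr_ge0.
Qed.

(** Unrolling from [j] to [k] produces the factors of index j to k - 1 only; restoring the earlier
    ones, all at least 1, gives a product bounded by [C]. *)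
Lemma quasi_fejer_le (R : realType) (a gamma : nat -> R) (C : R) :
  (forall k, 0 <= a k) -> (forall k, 0 <= gamma k) ->
  (forall k, \prod_(i < k) (1 + gamma i) <= C) ->
  (forall k, a k.+1 <= (1 + gamma k) * a k) ->
  forall j k, (j <= k)%N -> a k <= C * a j.
Proof.
move=> a0 g0 gC ale j k jk; rewrite -(subnKC jk).
have h i : a (j + i)%N <= \prod_(j <= l < j + i) (1 + gamma l) * a j.
  elim: i => [|i ih]; first by rewrite addn0 big_geq// mul1r.
  rewrite addnS big_nat_recr ?leq_addr//= (le_trans (ale _))//.
  by rewrite (mulrC _ (1 + _)) -mulrA ler_wpM2l// addr_ge0.
apply: le_trans (h _) _; rewrite ler_wpM2r// (le_trans _ (gC (j + (k - j))%N))//.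
rewrite -(big_mkord xpredT (fun l => 1 + gamma l)).
rewrite (@big_cat_nat _ _ _ j 0)//= ?leq_addr//.
rewrite ler_peMl//; last first.
  by rewrite big_mkord; apply: (@prodr_ge1 _ _ (fun l => 1 + gamma l)) => i; rewrite lerDl.
by apply: prodr_ge0 => i _; rewrite addr_ge0.
Qed.

(** Dividing by the partial products [p k] absorbs the factors: [a k / p k] is nonincreasing and
    nonnegative, hence convergent, and its consecutive differences, which tend to 0, dominate
    [d k / p k]. *)
Lemma quasi_fejer_cvg0 (R : realType) (a d gamma : nat -> R) (C : R) :
  (forall k, 0 <= a k) -> (forall k, 0 <= d k) -> (forall k, 0 <= gamma k) ->
  (forall k, \prod_(i < k) (1 + gamma i) <= C) ->
  (forall k, a k.+1 <= (1 + gamma k) * (a k - d k)) ->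
  d @ \oo --> 0.
Proof.
move=> a0 d0 g0 gC ale; pose p k := \prod_(i < k) (1 + gamma i).
have p1 k : 1 <= p k by apply: (@prodr_ge1 _ _ (fun l => 1 + gamma l)) => i; rewrite lerDl.
have p0 k : 0 < p k by exact: lt_le_trans (p1 k).
pose b k := a k / p k.
have db k : d k / p k <= b k - b k.+1.
  have g1 : 0 < 1 + gamma k by rewrite ltr_wpDr.
  have pS : p k.+1 = p k * (1 + gamma k) by rewrite /p big_ord_recr.
  have : a k.+1 / p k.+1 <= (a k - d k) / p k.
    by rewrite pS ler_pdivrMr ?mulr_gt0// mulrA divfK ?gt_eqF// mulrC.
  by rewrite mulrBl !lerBrDr addrC.
have bN k : b k.+1 <= b k.
  rewrite -subr_ge0; apply: le_trans (db k).
  by rewrite divr_ge0// ltW.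
have cb : cvgn b.
  apply: nonincreasing_is_cvgn; first by apply/nonincreasing_seqP.
  by exists 0 => _ [k _ <-]; rewrite divr_ge0// ltW.
have cdb : C * (b k - b k.+1) @[k --> \oo] --> 0.
  rewrite -(mulr0 C) -(subrr (limn b)); apply: cvgM; first exact: cvg_cst.
  by apply: cvgB => //; rewrite (cvg_shiftS b).
apply: (squeeze_cvgr _ (cvg_cst 0) cdb); near=> k; rewrite d0/=.
have -> : d k = p k * (d k / p k) by rewrite mulrC divfK// gt_eqF.
have p0' := ltW (p0 k).
by apply: ler_pM; [|rewrite divr_ge0|exact: gC|exact: db].
Unshelve. all: by end_near.
Qed.

(** * Optimality conditions of the two subproblems *)

(** The remainder of the first-order expansion is |A z - A x|^2 / 2. *)
Lemma least_squares_subgrad (R : realType) (m n : nat) (A : 'M[R]_(m, n))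
    (b : 'cV[R]_m) (x : 'cV[R]_n) :
  subdiff (EFin \o least_squares A b) x (A^T *m (A *m x - b)).
Proof.
move=> z /=; rewrite -EFinD lee_fin /least_squares !sqr_enorm.
rewrite -dot_mulmxr mulmxBr.
have := dot_ge0 (A *m z - A *m x).
rewrite !linE (dotC b) (dotC b) (dotC (A *m z) (A *m x)); lra.
Qed.

Lemma y_objective_subdiff (R : realType) (n : nat) (g : 'cV[R]_n -> \bar R)
    (beta : R) (S : 'M[R]_n) (xn yk lamk y : 'cV[R]_n) :
  proper_efun g -> econvex g -> psd S ->
  is_minimizer (y_objective g beta S xn yk lamk) y ->
  subdiff g y (- (lamk - beta *: (xn - y) + S *m (y - yk))).
Proof.
move=> pg cg S0 miny; apply: (@subdiff_minimizer _ _ g (fun z => - dot lamk (xn - z)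
  + beta / 2 * enorm (xn - z) ^+ 2 + 2^-1 * Defs.gnorm S (z - yk) ^+ 2)) => // d.
(* Half the Hessian form of the smooth part, whose Hessian is beta I + S. *)
exists (beta / 2 * dot d d + 2^-1 * dot d (S *m d)) => t.
rewrite !sqr_enorm !sqr_gnorm// !linE -!scalemxAr !linE.
rewrite (psd_sym y d S0) (psd_sym yk d S0) (psd_sym yk y S0).
rewrite !(dotC (S *m _) d) (dotC d y) (dotC d xn) (dotC y xn); lra.
Qed.

(** * The energy and its decrease in one iteration *)

(** The squared norm of (x, y, l) in the block-diagonal metric with blocks G, beta I + S and I /
    beta. *)
Definition energy (R : realType) (n : nat) (beta : R) (S G : 'M[R]_n)
    (x y l : 'cV[R]_n) : R :=
  beta^-1 * dot l l + beta * dot y y + dot y (S *m y) + dot x (G *m x).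

Lemma energy_ge (R : realType) (n : nat) (beta : R) (S G : 'M[R]_n)
    (x y l : 'cV[R]_n) : 0 < beta -> psd S -> psd G ->
  [/\ beta^-1 * dot l l <= energy beta S G x y l,
      beta * dot y y <= energy beta S G x y l,
      dot x (G *m x) <= energy beta S G x y l
    & 0 <= energy beta S G x y l].
Proof.
move=> b0 S0 G0; rewrite /energy; have bV0 : 0 <= beta^-1 by rewrite invr_ge0 ltW.
have := mulr_ge0 bV0 (dot_ge0 l); have := mulr_ge0 (ltW b0) (dot_ge0 y).
by have := psd_ge0 y S0; have := psd_ge0 x G0; split; lra.
Qed.

(** Here [x], [y], [l] are the new errors, [dx], [dy], [dl] the increments leading to them, and
    [dy'] the previous y-increment. By polarization the energy difference is twice the inner product
    of new error and increment. The first two monotonicity inequalities bound it by 2 <dy, dl>, and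
    the third bounds this by |dy'|_S^2 - |dy|_S^2. *)
Lemma energy_decrease (R : realType) (n : nat) (beta : R) (S G : 'M[R]_n)
    (x y l dx dy dl dy' : 'cV[R]_n) :
  0 < beta -> psd S -> psd G ->
  dl = - beta *: (x - y) ->
  0 <= dot x (l - beta *: dy - G *m dx) ->
  0 <= dot y (- (l + S *m dy)) ->
  0 <= dot dy (- (dl + S *m (dy - dy'))) ->
  energy beta S G x y l + dot dy (S *m dy) <=
  energy beta S G (x - dx) (y - dy) (l - dl) + dot dy' (S *m dy')
    - energy beta S G dx dy dl.
Proof.
move=> b0 S0 G0 dlE.
have e1 : beta^-1 * dot l dl = - (dot x l - dot y l).
  rewrite dlE dotZr mulrA mulrN mulVf ?gt_eqF// mulN1r !linE.
  by rewrite (dotC l x) (dotC l y).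
have e2 : dot dy dl = - (beta * (dot x dy - dot y dy)).
  by rewrite dlE dotZr mulNr !linE (dotC dy x) (dotC dy y).
have := psd_ge0 (dy - dy') S0.
rewrite /energy !linE (psd_sym dy y S0) (psd_sym dx x G0) (psd_sym dy' dy S0).
rewrite (dotC dl l) (dotC dy y) e2; lra.
Qed.

(* [G k] stands for [T_(k+1)], since only [T_1, T_2, ...] are bounded below by
   [T]; the energies at index [k] accordingly concern the iterates [k + 1]. *)
Section Convergence.
Variables (R : realType) (m n : nat) (A : 'M[R]_(m, n)) (b : 'cV[R]_m).
Variables (g : 'cV[R]_n -> \bar R) (beta : R) (S : 'M[R]_n).
Variables (x y lam : nat -> 'cV[R]_n) (G : nat -> 'M[R]_n).
Variables (gamma : nat -> R) (C : R).
Hypotheses (g_proper : proper_efun g) (g_closed : lower_semicontinuous g).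
Hypotheses (beta_gt0 : 0 < beta) (S_psd : psd S) (G_psd : forall k, psd (G k)).
Hypothesis G_le : forall k, loewner_le (G k.+1) ((1 + gamma k) *: G k).
Hypothesis gamma_ge0 : forall k, 0 <= gamma k.
Hypothesis gamma_prod : forall k, \prod_(i < k) (1 + gamma i) <= C.
Hypothesis x_opt : forall k, A^T *m (A *m x k.+2 - b) =
  lam k.+2 - beta *: increment y k.+1 - G k *m increment x k.+1.
Hypothesis y_opt : forall k,
  subdiff g (y k.+1) (- (lam k.+1 + S *m increment y k)).
Hypothesis lam_upd : forall k, lam k.+1 = lam k - beta *: (x k.+1 - y k.+1).

Let f := least_squares A b.

(** * Energy of the errors along the iteration *)

Definition error_energy (xs ls : 'cV[R]_n) (k : nat) : R :=
  energy beta S (G k) (x k.+1 - xs) (y k.+1 - xs) (lam k.+1 - ls)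
  + dot (increment y k) (S *m increment y k).

Definition step_energy (k : nat) : R :=
  energy beta S (G k) (increment x k.+1) (increment y k.+1) (increment lam k.+1).

Lemma error_energy_ge xs ls k :
  [/\ beta^-1 * dot (lam k.+1 - ls) (lam k.+1 - ls) <= error_energy xs ls k,
      beta * dot (y k.+1 - xs) (y k.+1 - xs) <= error_energy xs ls k
    & 0 <= error_energy xs ls k].
Proof.
have [h1 h2 _ h3] :=
  energy_ge (x k.+1 - xs) (y k.+1 - xs) (lam k.+1 - ls) beta_gt0 S_psd (G_psd k).
by have := psd_ge0 (increment y k) S_psd; rewrite /error_energy; split; lra.
Qed.

(** Monotonicity is applied three times: for [f] and for [g] between the new iterate and the
    reference point, and for [g] between two successive y-iterates. *)
Lemma error_energy_step xs ls :
  subdiff (EFin \o f) xs ls -> subdiff g xs (- ls) -> forall k,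
  error_energy xs ls k.+1 <=
    (1 + gamma k) * (error_energy xs ls k - step_energy k).
Proof.
move=> fs gs k.
have f_proper : proper_efun (EFin \o f) by split => [z|]//; exists 0.
have := subdiff_monotone f_proper (@least_squares_subgrad _ _ _ A b (x k.+2)) fs.
have := subdiff_monotone g_proper (y_opt k.+1) gs.
have := subdiff_monotone g_proper (y_opt k.+1) (y_opt k).
rewrite x_opt -/(increment y k.+1).
rewrite (_ : - (lam k.+2 + S *m increment y k.+1) - - ls
  = - ((lam k.+2 - ls) + S *m increment y k.+1)); last first.
  by rewrite !opprD !opprK addrAC.
rewrite (_ : - (lam k.+2 + S *m increment y k.+1) - - (lam k.+1 + S *m increment y k)
  = - (increment lam k.+1 + S *m (increment y k.+1 - increment y k))); last first.
  rewrite /(increment lam _); move: (increment y _) (increment y _) => u v.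
  by rewrite mulmxBr opprK !opprD !opprK addrACA.
rewrite (_ : lam k.+2 - beta *: increment y k.+1 - G k *m increment x k.+1 - ls
  = (lam k.+2 - ls) - beta *: increment y k.+1 - G k *m increment x k.+1);
  last by rewrite 2!(addrAC _ _ (- ls)).
move=> hd hy hx.
have hl : increment lam k.+1 = - beta *: ((x k.+2 - xs) - (y k.+2 - xs)).
  by rewrite opprB addrA subrK /increment lam_upd addrAC subrr add0r scaleNr.
have := energy_decrease beta_gt0 S_psd (G_psd k) hl hx hy hd.
have sub_inc (u : nat -> 'cV[R]_n) v : u k.+2 - v - increment u k.+1 = u k.+1 - v.
  by rewrite /increment opprB addrC addrA subrK.
rewrite !sub_inc -/(error_energy _ _ _) -/(step_energy _) => dec.
have g1 : 0 <= 1 + gamma k by rewrite addr_ge0.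
apply: le_trans (ler_wpM2l g1 dec).
(* Replacing [G k] by [G k.+1] costs the factor 1 + gamma_k in the x-term; the other terms are
   nonnegative and can be enlarged by the same factor. *)
have := loewner_leP (x k.+2 - xs) (G_le k); rewrite -scalemxAl dotZr.
have bV0 : 0 <= beta^-1 by rewrite invr_ge0 ltW.
have h1 := mulr_ge0 (gamma_ge0 k) (mulr_ge0 bV0 (dot_ge0 (lam k.+2 - ls))).
have h2 := mulr_ge0 (gamma_ge0 k) (mulr_ge0 (ltW beta_gt0) (dot_ge0 (y k.+2 - xs))).
have h3 := mulr_ge0 (gamma_ge0 k) (psd_ge0 (y k.+2 - xs) S_psd).
have h4 := mulr_ge0 (gamma_ge0 k) (psd_ge0 (increment y k.+1) S_psd).
rewrite /error_energy /energy; lra.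
Qed.

Lemma step_energy_ge k :
  [/\ beta^-1 * dot (increment lam k.+1) (increment lam k.+1) <= step_energy k,
      beta * dot (increment y k.+1) (increment y k.+1) <= step_energy k,
      dot (increment x k.+1) (G k *m increment x k.+1) <= step_energy k
    & 0 <= step_energy k].
Proof. exact: energy_ge. Qed.

Lemma error_energy_le xs ls :
  subdiff (EFin \o f) xs ls -> subdiff g xs (- ls) ->
  forall j k, (j <= k)%N -> error_energy xs ls k <= C * error_energy xs ls j.
Proof.
move=> fs gs; apply: quasi_fejer_le gamma_ge0 gamma_prod _ => k.
  by have [] := error_energy_ge xs ls k.
apply: le_trans (error_energy_step fs gs k) _.
rewrite ler_wpM2l ?addr_ge0// gerBl.
by have [] := step_energy_ge k.
Qed.

(** A bound on the varying metrics by a fixed one: for fixed [z] the values of the forms grow at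
    most by the factors 1 + gamma_k. *)
Lemma G_quad_le z k : dot z (G k *m z) <= C * dot z (G 0%N *m z).
Proof.
apply: (@quasi_fejer_le _ (fun k => dot z (G k *m z)) _ _ _ gamma_ge0 gamma_prod) => // {}k.
  exact: psd_ge0.
by have := loewner_leP z (G_le k); rewrite -scalemxAl dotZr.
Qed.

(** * Vanishing of the increments and residuals *)

Lemma scaled_dot_cvg0 (u : nat -> 'cV[R]_n) (e : nat -> R) (c : R) : 0 < c ->
  (forall k, c * dot (u k) (u k) <= e k) -> e @ \oo --> 0 ->
  u @ \oo --> (0 : 'cV[R]_n).
Proof.
move=> c0 ue e0; apply: cvg_dot0.
have ce : c^-1 * e k @[k --> \oo] --> 0.
  by rewrite -(mulr0 c^-1); apply: cvgM => //; exact: cvg_cst.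
apply: (squeeze_cvgr _ (cvg_cst 0) ce); near=> k.
by rewrite dot_ge0 ler_pdivlMl//=; exact: ue.
Unshelve. all: by end_near.
Qed.

Lemma primal_gap_cvg0 : increment lam @ \oo --> (0 : 'cV[R]_n) ->
  (fun k => x k.+1 - y k.+1) @ \oo --> (0 : 'cV[R]_n).
Proof.
move=> l0; have -> : (fun k => x k.+1 - y k.+1) = (fun k => - beta^-1 *: increment lam k).
  apply/funext => k; rewrite /increment lam_upd addrAC subrr add0r.
  by rewrite scaleNr scalerN opprK scalerA mulVf ?gt_eqF// scale1r.
apply/cvg_colP => i; rewrite mxE -(mulr0 (- beta^-1)).
under eq_fun do rewrite mxE.
move/cvg_colP : l0 => /(_ i); rewrite mxE => l0.
by apply: cvgM => //; exact: cvg_cst.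
Qed.

Section ReferencePoint.
Variables xs ls : 'cV[R]_n.
Hypotheses (f_ref : subdiff (EFin \o f) xs ls) (g_ref : subdiff g xs (- ls)).

Lemma step_energy_cvg0 : step_energy @ \oo --> 0.
Proof.
apply: (quasi_fejer_cvg0 (a := error_energy xs ls) _ _ gamma_ge0 gamma_prod).
- by move=> k; have [] := error_energy_ge xs ls k.
- by move=> k; have [] := step_energy_ge k.
- exact: error_energy_step.
Qed.

Lemma increment_y_cvg0 : increment y @ \oo --> (0 : 'cV[R]_n).
Proof.
rewrite -cvg_shiftS; apply: scaled_dot_cvg0 beta_gt0 _ step_energy_cvg0 => k.
by have [] := step_energy_ge k.
Qed.

Lemma increment_lam_cvg0 : increment lam @ \oo --> (0 : 'cV[R]_n).
Proof.
have bV0 : 0 < beta^-1 by rewrite invr_gt0.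
rewrite -cvg_shiftS; apply: scaled_dot_cvg0 bV0 _ step_energy_cvg0 => k.
by have [] := step_energy_ge k.
Qed.

(** [G k] may be singular, so the energy need not control the x-increment itself. Cauchy-Schwarz for
    [G k] against each basis vector [e] still bounds the squared coordinate by C <e, G_0 e> times
    the step energy. *)
Lemma prox_term_cvg0 : (fun k => G k *m increment x k.+1) @ \oo --> (0 : 'cV[R]_n).
Proof.
apply/cvg_colP => i; rewrite mxE; pose e : 'cV[R]_n := delta_mx i 0.
have eE (v : 'cV[R]_n) : v i 0 = dot e v.
  rewrite dotE (bigD1 i)//= !mxE !eqxx mul1r big1 ?addr0// => j ji.
  by rewrite mxE (negbTE ji) mul0r.
apply/norm_cvg0P; rewrite -sqrtr0; under eq_fun do rewrite -sqrtr_sqr.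
apply: (continuous_cvg _ (@sqrt_continuous R 0)).
have cE : C * dot e (G 0%N *m e) * step_energy k @[k --> \oo] --> 0.
  rewrite -[X in _ --> X](mulr0 (C * dot e (G 0%N *m e))).
  by apply: cvgM; [exact: cvg_cst|exact: step_energy_cvg0].
apply: (squeeze_cvgr _ (cvg_cst 0) cE); near=> k.
rewrite sqr_ge0/= eE; apply: le_trans (psd_cauchy_schwarz _ _ (G_psd k)) _.
have [_ _ h _] := step_energy_ge k.
by apply: ler_pM => //; [exact: psd_ge0|exact: psd_ge0|exact: G_quad_le].
Unshelve. all: by end_near.
Qed.

End ReferencePoint.

(** * Cluster points and convergence of the iterates *)

(** The limit passes through [y_opt] by closedness of the subdifferential and through [x_opt] by
    continuity of the gradient. A filter on indices need not be shift-invariant, so the limits of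
    the iterates k + 2 in [x_opt] are recovered from those of index k + 1 by vanishing increments
    and gaps. *)
Lemma cluster_point_kkt (F : set_system nat) (p l : 'cV[R]_n) :
  ProperFilter F ->
  (fun k => x k.+1 - y k.+1) @ F --> (0 : 'cV[R]_n) ->
  increment y @ F --> (0 : 'cV[R]_n) ->
  (fun k => increment y k.+1) @ F --> (0 : 'cV[R]_n) ->
  (fun k => increment lam k.+1) @ F --> (0 : 'cV[R]_n) ->
  (fun k => x k.+2 - y k.+2) @ F --> (0 : 'cV[R]_n) ->
  (fun k => G k *m increment x k.+1) @ F --> (0 : 'cV[R]_n) ->
  (fun k => y k.+1) @ F --> p -> (fun k => lam k.+1) @ F --> l ->
  subdiff (EFin \o f) p l /\ subdiff g p (- l).
Proof.
move=> FF gap dy dy' dlam gap' prox yp laml; split; last first.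
  apply: (subdiff_closed FF g_proper g_closed yp _ y_opt).
  rewrite -[l]addr0 -(mulmx0 _ S); apply: cvgN; apply: cvgD => //.
  exact: cvg_mulmx.
have laml' : (fun k => lam k.+2) @ F --> l.
  rewrite -[l]add0r; have -> : (fun k => lam k.+2) = (fun k => increment lam k.+1 + lam k.+1).
    by apply/funext => k; rewrite /increment subrK.
  exact: cvgD.
have xp' : (fun k => x k.+2) @ F --> p.
  rewrite -[p]add0r -[0]add0r.
  have -> : (fun k => x k.+2) = (fun k => (x k.+2 - y k.+2) + increment y k.+1 + y k.+1).
    by apply/funext => k; rewrite /increment addrA !subrK.
  by apply: cvgD => //; exact: cvgD.
suff -> : l = A^T *m (A *m p - b) by exact: least_squares_subgrad.
have c1 : (fun k => A^T *m (A *m x k.+2 - b)) @ F --> A^T *m (A *m p - b).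
  by apply: cvg_mulmx; apply: cvgB; [exact: cvg_mulmx|exact: cvg_cst].
have c2 : (fun k => A^T *m (A *m x k.+2 - b)) @ F --> l.
  under eq_fun do rewrite x_opt.
  have lE : l - beta *: 0 - 0 = l by rewrite scaler0 !subr0.
  rewrite -lE; apply: cvgB => //; apply: cvgB => //.
  apply/cvg_colP => i; rewrite mxE; under eq_fun do rewrite mxE.
  by apply: cvgM; [exact: cvg_cst|move/cvg_colP : dy'].
apply/colP => i; move/cvg_colP : c1 => /(_ i) c1; move/cvg_colP : c2 => /(_ i) c2.
exact: (cvg_unique (@Rhausdorff R) c2 c1).
Qed.

Lemma error_energy_cvg0_filter (F : set_system nat) (p l : 'cV[R]_n) :
  ProperFilter F -> increment y @ F --> (0 : 'cV[R]_n) ->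
  (fun k => x k.+1) @ F --> p -> (fun k => y k.+1) @ F --> p ->
  (fun k => lam k.+1) @ F --> l -> error_energy p l @ F --> 0.
Proof.
move=> FF dy xp yp laml.
have cvg_err (u : nat -> 'cV[R]_n) (q : 'cV[R]_n) :
    u @ F --> q -> (fun k => u k - q) @ F --> (0 : 'cV[R]_n).
  by move=> uq; rewrite -(subrr q); apply: cvgB => //; exact: cvg_cst.
have cvg_quad (M : 'M[R]_n) (u : nat -> 'cV[R]_n) :
    u @ F --> (0 : 'cV[R]_n) -> dot (u k) (M *m u k) @[k --> F] --> 0.
  move=> u0; have -> : 0 = dot (0 : 'cV[R]_n) (M *m 0).
    by rewrite mulmx0 /dot mulmx0 mxE.
  by apply: cvg_dot => //; exact: cvg_mulmx.
have cvg_sqr (u : nat -> 'cV[R]_n) :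
    u @ F --> (0 : 'cV[R]_n) -> dot (u k) (u k) @[k --> F] --> 0.
  by move=> /(cvg_quad 1%:M); under eq_fun do rewrite mul1mx.
have cvgMl (c : R) (u : nat -> R) : u @ F --> 0 -> c * u k @[k --> F] --> 0.
  by move=> u0; rewrite -(mulr0 c); apply: cvgM => //; exact: cvg_cst.
(* The metric varies with [k], so this term is squeezed below C times the form of the fixed
   [G 0]. *)
have xG : dot (x k.+1 - p) (G k *m (x k.+1 - p)) @[k --> F] --> 0.
  apply: (squeeze_cvgr _ (cvg_cst 0) (cvgMl C _ (cvg_quad (G 0%N) _ (cvg_err _ _ xp)))).
  by apply: nearW => k; rewrite psd_ge0//= G_quad_le.
have -> : 0 = 0 + 0 + 0 + 0 + 0 :> R by rewrite !addr0.
apply: cvgD; last exact: cvg_quad.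
apply: cvgD => //; apply: cvgD; last exact: cvg_quad (cvg_err _ _ yp).
by apply: cvgD; apply: cvgMl; apply: cvg_sqr; exact: cvg_err.
Qed.

(** The filter only has to supply one index where the energy is at most e / C; [error_energy_le]
    then keeps it below e at all later indices. *)
Lemma error_energy_cvg0 (F : set_system nat) (p l : 'cV[R]_n) :
  ProperFilter F -> subdiff (EFin \o f) p l -> subdiff g p (- l) ->
  error_energy p l @ F --> 0 -> error_energy p l @ \oo --> 0.
Proof.
move=> FF fp gp err0; apply/cvgrPdist_le => e e0.
have C1 : 0 < C by rewrite (lt_le_trans ltr01)// (le_trans _ (gamma_prod 0%N))// big_ord0.
have /cvgrPdist_le /(_ (e / C)) := err0.
rewrite divr_gt0// => /(_ isT)/filter_ex [j].
have a0 k : 0 <= error_energy p l k by have [] := error_energy_ge p l k.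
rewrite sub0r normrN ger0_norm// ler_pdivlMr// mulrC => ej.
near=> k; rewrite sub0r normrN ger0_norm//.
by apply: le_trans ej; apply: error_energy_le => //; near: k; exact: nbhs_infty_ge.
Unshelve. all: by end_near.
Qed.

Lemma iterates_cvg (xs ls : 'cV[R]_n) :
  subdiff (EFin \o f) xs ls -> subdiff g xs (- ls) ->
  exists p l : 'cV[R]_n, [/\ subdiff (EFin \o f) p l, subdiff g p (- l),
    x @ \oo --> p, y @ \oo --> p & lam @ \oo --> l].
Proof.
move=> fs gs.
have dlam := increment_lam_cvg0 fs gs; have dy := increment_y_cvg0 fs gs.
have prox := prox_term_cvg0 fs gs; have gap := primal_gap_cvg0 dlam.
(* Limits along an ultrafilter finer than [\oo] replace convergent subsequences. *)
have [F [FU ooF]] := @ultraFilterLemma nat \oo _.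
have FF : ProperFilter F by exact: ultra_proper.
have toF (u : nat -> 'cV[R]_n) (q : 'cV[R]_n) : u @ \oo --> q -> u @ F --> q.
  by move=> uq V /uq /ooF.
have shift (u : nat -> 'cV[R]_n) (q : 'cV[R]_n) :
    u @ \oo --> q -> (fun k => u k.+1) @ \oo --> q by rewrite -cvg_shiftS.
have bV0 : 0 < beta^-1 by rewrite invr_gt0.
have centered_cvg (u : nat -> 'cV[R]_n) (q : 'cV[R]_n) (B : R) :
    (forall k, dot (u k - q) (u k - q) <= B) -> exists l : 'cV[R]_n, u @ F --> l.
  move=> /(ultra_cvg_bounded FU)[l ul]; exists (l + q).
  have -> : u = (fun k => (u k - q) + q) by apply/funext => k; rewrite subrK.
  by apply: cvgD => //; exact: cvg_cst.
have [l laml] : exists l : 'cV[R]_n, (fun k => lam k.+1) @ F --> l.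
  apply: (centered_cvg _ ls (beta^-1^-1 * (C * error_energy xs ls 0%N))) => k.
  rewrite ler_pdivlMl//; have [h _ _] := error_energy_ge xs ls k.
  exact: le_trans h (error_energy_le fs gs (leq0n k)).
have [p yp] : exists p : 'cV[R]_n, (fun k => y k.+1) @ F --> p.
  apply: (centered_cvg _ xs (beta^-1 * (C * error_energy xs ls 0%N))) => k.
  rewrite ler_pdivlMl//; have [_ h _] := error_energy_ge xs ls k.
  exact: le_trans h (error_energy_le fs gs (leq0n k)).
have [fp gp] : subdiff (EFin \o f) p l /\ subdiff g p (- l).
  exact: (cluster_point_kkt FF (toF _ _ gap) (toF _ _ dy) (toF _ _ (shift _ _ dy))
    (toF _ _ (shift _ _ dlam)) (toF _ _ (shift _ _ gap)) (toF _ _ prox) yp laml).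
have xp : (fun k => x k.+1) @ F --> p.
  rewrite -[p]add0r; have -> : (fun k => x k.+1) = (fun k => (x k.+1 - y k.+1) + y k.+1).
    by apply/funext => k; rewrite subrK.
  by apply: cvgD => //; exact: toF.
have err0 := error_energy_cvg0 FF fp gp (error_energy_cvg0_filter FF (toF _ _ dy) xp yp laml).
have recenter (u : nat -> 'cV[R]_n) (q : 'cV[R]_n) :
    (fun k => u k.+1 - q) @ \oo --> (0 : 'cV[R]_n) -> u @ \oo --> q.
  move=> uq; rewrite -cvg_shiftS -[q]add0r.
  have -> : [sequence u k.+1]_k = (fun k => (u k.+1 - q) + q).
    by apply/funext => k; rewrite subrK.
  by apply: cvgD => //; exact: cvg_cst.
have ycvg : y @ \oo --> p.
  apply: recenter; apply: scaled_dot_cvg0 beta_gt0 _ err0 => k.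
  by have [] := error_energy_ge p l k.
exists p, l; split=> //.
(* The energy sees [x] only through the semidefinite [G k], so its limit comes from that of [y] and
   the vanishing gap. *)
- rewrite -cvg_shiftS -[p]add0r.
  have -> : [sequence x k.+1]_k = (fun k => (x k.+1 - y k.+1) + y k.+1).
    by apply/funext => k; rewrite subrK.
  by apply: cvgD => //; exact: shift.
- apply: recenter; apply: scaled_dot_cvg0 bV0 _ err0 => k.
  by have [] := error_energy_ge p l k.
Qed.
End Convergence.

(** * Application to runs of ADM-BFGS *)

Theorem theorem2p5 (R : realType) (m n : nat)
    (A : 'M[R]_(m, n)) (b : 'cV[R]_m)
    (g : 'cV[R]_n -> \bar R) (beta : R) (S : 'M[R]_n)
    (rule : qn_rule) (kbar : \bar R)
    (H : nat -> 'M[R]_n) (x y lam : nat -> 'cV[R]_n)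
    (g_proper : proper_efun g) (g_convex : econvex g)
    (g_closed : lower_semicontinuous g)
    (beta_gt0 : 0 < beta) (S_psd : psd S)
    (kkt_nonempty : kkt (least_squares A b) g !=set0)
    (run : adm_bfgs A b g beta S rule kbar H x y lam)
    (T : 'M[R]_n) (gamma : nat -> R) (T_psd : psd T)
    (T_lower : forall k : nat, loewner_le T (Tmx A beta H k.+1))
    (T_upper : forall k : nat,
      loewner_le (Tmx A beta H k.+1) ((1 + gamma k) *: Tmx A beta H k))
    (gamma_ge0 : forall k : nat, 0 <= gamma k)
    (gamma_summable : (\sum_(0 <= k <oo) (gamma k)%:E < +oo)%E) :
  exists xs ys lams : 'cV[R]_n,
    kkt (least_squares A b) g (xs, ys, lams) /\
    (fun k : nat => (x k, y k, lam k)) @ \oo --> (xs, ys, lams).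
Proof.
have [[[xs ys] ls] /= [ef [eg [fs gs]]]] := kkt_nonempty.
move=> /eqP; rewrite subr_eq0 => /eqP efE; rewrite {}efE in fs.
move=> /eqP; rewrite addr_eq0 => /eqP egE; rewrite {}egE in gs.
move=> /eqP; rewrite subr_eq0 => /eqP xyE; rewrite -{}xyE in gs.
have T_psd' k : psd (Tmx A beta H k.+1) by exact: psd_loewner (T_lower k).
have AtA_psd : psd (A^T *m A).
  split => [|z]; first by rewrite trmx_mul trmxK.
  by rewrite quadE -mulmxA dot_mulmxr trmxK dot_ge0.
have H_unit k : H k.+1 \in unitmx.
  (* [invmx] is the identity on singular matrices, so [unitmx_inv] is
     unconditional. *)
  rewrite -unitmx_inv.
  have -> : invmx (H k.+1) = (Tmx A beta H k.+1 + A^T *m A) + beta%:M.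
    by rewrite -addrA subrK.
  by apply: psd_scalar_unit => //; exact: psdD.
have [C prodC] := summable_prod_bounded gamma_ge0 gamma_summable.
have [p [l [fp gp xp yp laml]]] : exists p l : 'cV[R]_n,
    [/\ subdiff (EFin \o least_squares A b) p l, subdiff g p (- l),
        x @ \oo --> p, y @ \oo --> p & lam @ \oo --> l].
  apply: (@iterates_cvg R m n A b g beta S x y lam (fun k => Tmx A beta H k.+1)
    (fun k => gamma k.+1) C) gs => //.
  (* The shifted product omits the factor 1 + gamma_0, which is at least 1. *)
  - move=> k; apply: le_trans (prodC k.+1); rewrite big_ord_recl/=.
    rewrite ler_peMl ?lerDl//; apply: prodr_ge0 => i _.
    by rewrite addr_ge0.
  (* Multiplying the x-step of index k + 1 by H^-1 = T_(k+1) + M isolates the gradient of f at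
     x^{k+2}; the multiplier step then introduces lam^{k+2}. *)
  - move=> k; have := adm_x run k.+1.
    move=> /eqP; rewrite addrC -subr_eq => /eqP xE.
    have HxE : invmx (H k.+1) *m increment x k.+1
        = lam k.+1 + beta *: y k.+1 + A^T *m b - admM A beta *m x k.+1.
      by rewrite /increment xE mulKmx.
    have AAE : A^T *m (A *m x k.+2) = admM A beta *m x k.+2 - beta *: x k.+2.
      by rewrite /admM mulmxDl mul_scalar_mx addrK mulmxA.
    rewrite mulmxBl HxE (adm_lam run k.+1) mulmxBr AAE /increment mulmxBr.
    move: (admM A beta *m x k.+2) (admM A beta *m x k.+1) (A^T *m b) => u v w.
    by apply/colP => i; rewrite !mxE; ring.
  - move=> k; have := y_objective_subdiff g_proper g_convex S_psd (adm_y run k).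
    by rewrite -(adm_lam run k).
  - exact: adm_lam run.
exists p, p, l; split.
  by exists l, (- l); rewrite !subrr addNr.
exact: (cvg_pair (cvg_pair xp yp) laml).
Qed.
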